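(* Let $\mathcal{F}\subset 2^{\mathbb{N}}$ be an antichain, i.e. a family of subsets of $\mathbb{N}$ such that for all distinct $A,B\in\mathcal{F}$ we have $A\not\subset B$. Then $$\liminf_{n\rightarrow \infty}\big|\mathcal{F} \cap 2^{[n]}\big| \left(\frac{2^n}{ n\log n}\right)^{-1}=0.$$
   Context: $[n]=\{1,\dots,n\}$ and $2^{[n]}$ denotes the family of all subsets of $[n]$, so $\mathcal{F}\cap 2^{[n]}$ is the set of members of $\mathcal{F}$ contained in $[n]$. *)

(* Defs.v *)
From mathcomp Require Import all_boot all_order all_algebra finmap.
From mathcomp Require Import all_classical all_reals all_analysis.

Set Implicit Arguments.
Unset Strict Implicit.
Unset Printing Implicit Defensive.

Local Open Scope classical_set_scope.

Definition antichain (T : Type) (F : set (set T)) : Prop :=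
  forall A B : set T, F A -> F B -> A <> B -> ~ (A `<=` B).

Definition initial_segment (n : nat) : set nat := [set k | (1 <= k <= n)%N].

Definition subsets (T : Type) (X : set T) : set (set T) := [set A | A `<=` X].

Lemma finite_subsets_initial_segment (n : nat) :
  finite_set (subsets (initial_segment n)).
Proof.
pose f (s : {set 'I_n.+1}) : set nat := [set k | exists2 i, i \in s & val i = k].
apply: (@sub_finite_set _ _ (f @` [set: {set 'I_n.+1}])); last first.
  exact/finite_image/finite_finset.
move=> A sA; exists [set i : 'I_n.+1 | `[< A (val i) >]]%SET => //.
apply/seteqP; split=> k /=.
  by case=> i; rewrite inE => /asboolP Ai <-.
move=> Ak; have /andP[_ kn] := sA _ Ak.
by exists (Ordinal (kn : (k < n.+1)%N)) => //; rewrite inE; apply/asboolP.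
Qed.

(* [fset_set] sends an infinite set to the empty one, but the set below is
   always finite, by [finite_subsets_initial_segment]. The element 0 belongs to
   no [initial_segment n], so it does not matter whether the members of F are
   taken as sets of positive integers or as sets of natural numbers. *)
Definition trace_card (F : set (set nat)) (n : nat) : nat :=
  #|` fset_set (F `&` subsets (initial_segment n)) |%fset.

(* Main.v *)
(* A Kraft-type inequality. Let s_n count the members of F contained in [n] and
   c_n the subsets of [n] that contain no member of F. Splitting according to
   whether n + 1 is an element gives s_(n+1) + c_(n+1) <= s_n + 2 c_n, so that
   sum_(k <= n) s_k / 2^k + (s_n + 2 c_n) / 2^n is nonincreasing in n, hence at
   most 2. Since sum 1 / (n ln n) diverges (compare with the telescoping sum of
   ln (ln (n + 1)) - ln (ln n)), s_n cannot eventually exceed e 2^n / (n ln n). *)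
Require Import Defs.
From mathcomp Require Import all_boot all_order all_algebra finmap.
From mathcomp Require Import all_classical all_reals all_analysis.
From mathcomp Require Import zify lra.

Set Implicit Arguments.
Unset Strict Implicit.
Unset Printing Implicit Defensive.

Import Order.TTheory GRing.Theory Num.Theory.

Local Open Scope classical_set_scope.
Local Open Scope ring_scope.

Definition avoiding (T : Type) (F : set (set T)) : set (set T) :=
  [set B | forall A, F A -> ~ (A `<=` B)].

Lemma sub_initial_segmentS (n : nat) (B : set nat) :
  B `<=` initial_segment n.+1 -> ~ B n.+1 -> B `<=` initial_segment n.
Proof.
move=> sB nB k Bk; have /andP[k0 kn] := sB _ Bk.
apply/andP; split=> //; rewrite -ltnS ltn_neqAle kn andbT.
by apply/eqP => kE; apply: nB; rewrite -kE.
Qed.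

Lemma initial_segmentUS (n : nat) (B : set nat) :
  B `<=` initial_segment n.+1 -> B n.+1 ->
  n.+1 |` (B `&` initial_segment n) = B.
Proof.
move=> sB Bn; apply/seteqP; split=> [k [->//|[]//]|k Bk].
have [->|kn] := eqVneq k n.+1; first by left.
have /andP[k0 kSn] := sB _ Bk.
by right; split=> //; apply/andP; split=> //; rewrite -ltnS ltn_neqAle kn.
Qed.

Lemma finite_setI_subsets (F : set (set nat)) (n : nat) :
  finite_set (F `&` subsets (initial_segment n)).
Proof.
apply: sub_finite_set (finite_subsets_initial_segment n); exact: subIsetr.
Qed.

Lemma trace_card_sub (F G : set (set nat)) (n : nat) :
  F `&` subsets (initial_segment n) `<=` G ->
  finite_set G -> (trace_card F n <= #|` fset_set G|%fset)%N.
Proof.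
move=> FG finG; apply: fsubset_leq_card.
by rewrite -fset_set_sub//; exact: finite_setI_subsets.
Qed.

Lemma trace_cardU (F G : set (set nat)) (n : nat) :
  F `&` G = set0 ->
  trace_card (F `|` G) n = (trace_card F n + trace_card G n)%N.
Proof.
move=> FG0; rewrite /trace_card setIUl fset_setU; [|exact: finite_setI_subsets..].
rewrite -cardfsUI -fset_setI; [|exact: finite_setI_subsets..].
by rewrite setIACA FG0 set0I fset_set0 cardfs0 addn0.
Qed.

Lemma avoiding_disjoint (T : Type) (F : set (set T)) : F `&` avoiding F = set0.
Proof. by apply/seteqP; split=> // B [FB /(_ _ FB)]; apply. Qed.

Section Recurrence.
Variable F : set (set nat).
Hypothesis antiF : antichain F.

(** The only subset of the empty segment is the empty set, and it cannot both belong to [F] and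
    avoid [F]. *)
Lemma trace_card_avoiding0 : (trace_card F 0 + trace_card (avoiding F) 0 <= 1)%N.
Proof.
rewrite -trace_cardU; last exact: avoiding_disjoint.
rewrite -(cardfs1 (set0 : set nat)) -fset_set1; apply: trace_card_sub => //.
move=> B [_ sB]; apply/seteqP; split=> // k /sB/=.
by rewrite /initial_segment/= leqn0 lt0n => /andP[/negPf->].
Qed.

(* If [n.+1 \in B], then [B `&` initial_segment n] avoids F, by the antichain
   property when [B] is in F. *)
Lemma trace_card_avoidingS (n : nat) :
  (trace_card F n.+1 + trace_card (avoiding F) n.+1 <=
   trace_card F n + (trace_card (avoiding F) n).*2)%N.
Proof.
rewrite -trace_cardU; last exact: avoiding_disjoint.
set Fn := F `&` subsets (initial_segment n).
set Cn := avoiding F `&` subsets (initial_segment n).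
have fFn : finite_set Fn by exact: finite_setI_subsets.
have fCn : finite_set Cn by exact: finite_setI_subsets.
have fC'n : finite_set (setU [set n.+1] @` Cn) by exact: finite_image.
have fCC' : finite_set (Cn `|` setU [set n.+1] @` Cn) by rewrite finite_setU; split.
apply: (@leq_trans #|` fset_set (Fn `|` (Cn `|` setU [set n.+1] @` Cn))|%fset).
  apply: trace_card_sub; last by rewrite finite_setU; split.
  (* If [n.+1] is in [B], then [B] arises by adding [n.+1] to a member of [Cn]; otherwise [B] is
     already contained in [n], so it lies in [Fn] or [Cn]. *)
  move=> B [FCB sB]; have [Bn|nBn] := pselect (B n.+1).
    right; right; exists (B `&` initial_segment n); last exact: initial_segmentUS.
    split; last exact: subIsetr.
    move=> A FA; rewrite subsetI => -[AB An]; case: FCB => [FB|CB]; last exact: CB AB.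
    (* Equality [A = B] would put [n.+1] into [n], since [A] is contained in [n]. *)
    apply: (antiF FA FB) => // AE; have /An : A n.+1 by rewrite AE.
    by rewrite /initial_segment/= ltnn.
  have sBn := sub_initial_segmentS sB nBn.
  by case: FCB => [FB|CB]; [left|right; left].
rewrite !fset_setU// fset_set_image//.
rewrite (leq_trans (leq_card_fsetU _ _))// leq_add2l.
rewrite (leq_trans (leq_card_fsetU _ _))// -addnn leq_add2l.
exact: leq_imfset_card.
Qed.

Lemma sum_trace_card_le2 (R : realType) (n : nat) :
  \sum_(0 <= k < n) (trace_card F k)%:R / 2 ^+ k <= 2 :> R.
Proof.
pose s k : R := (trace_card F k)%:R; pose c k : R := (trace_card (avoiding F) k)%:R.
suff H : \sum_(0 <= k < n.+1) s k / 2 ^+ k + (s n + 2 * c n) / 2 ^+ n <= 2.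
  apply: le_trans H; rewrite big_nat_recr//= -addrA lerDl.
  by rewrite addr_ge0// divr_ge0 ?addr_ge0 ?mulr_ge0// exprn_ge0.
elim: n => [|n IHn].
  (* The constant 2 arises here: the quantity at 0 is 2 (s 0 + c 0). *)
  rewrite big_nat1 expr0 !divr1.
  have : s 0 + c 0 <= 1 by rewrite /s /c -natrD lern1 trace_card_avoiding0.
  lra.
(* The new summand and the new last term add up to (s (n+1) + c (n+1)) / 2^n, which the recurrence
   bounds by the old last term. *)
rewrite big_nat_recr//=; apply: le_trans IHn; rewrite -addrA lerD2l.
rewrite -mulrDl exprS invfM mulrA ler_pM2r ?invr_gt0 ?exprn_gt0//.
have : s n.+1 + c n.+1 <= s n + 2 * c n.
  by rewrite /s /c -natrM -!natrD ler_nat mul2n trace_card_avoidingS.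
lra.
Qed.

End Recurrence.

Section LogLog.
Variable R : realType.

(** The bound ln (1 + x) <= x is used twice: first it gives ln (n + 1) <= ln n + 1/n, so the ratio
    of the two logarithms is at most 1 + 1/(n ln n); then it bounds the logarithm of that ratio. *)
Lemma lnln_diff_le (n : nat) : (1 < n)%N ->
  ln (ln n.+1%:R) - ln (ln n%:R) <= (n%:R * ln n%:R)^-1 :> R.
Proof.
move=> n1; have n0 : 0 < n%:R :> R by rewrite ltr0n; lia.
have ln0 : 0 < ln n%:R :> R by rewrite ln_gt0// ltr1n.
have lnS0 : 0 < ln n.+1%:R :> R by rewrite ln_gt0// ltr1n; lia.
rewrite -ln_div ?posrE//.
have lnS : ln n.+1%:R <= ln n%:R + n%:R^-1 :> R.
  have -> : n.+1%:R = n%:R * (1 + n%:R^-1) :> R.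
    by rewrite mulrDr mulr1 divff ?gt_eqF// -natr1.
  have V0 : 0 < n%:R^-1 :> R by rewrite invr_gt0.
  rewrite lnM ?posrE ?lerD2l ?addr_gt0//.
  by apply: le_ln1Dx; lra.
apply: (@le_trans _ _ (ln (1 + (n%:R * ln n%:R)^-1))).
  rewrite ler_ln ?posrE ?divr_gt0 ?addr_gt0 ?invr_gt0 ?mulr_gt0//.
  by rewrite ler_pdivrMr// mulrDl mul1r invfM mulfVK ?gt_eqF.
apply: le_ln1Dx; apply: (@lt_trans _ _ 0); first by lra.
by rewrite invr_gt0 mulr_gt0.
Qed.

Lemma sum_inv_nlnn_unbounded (m : nat) (x : R) : (1 < m)%N ->
  exists n, x < \sum_(m <= k < n) (k%:R * ln k%:R)^-1.
Proof.
(* [y] solves ln (ln y) = x + ln (ln m), so any [n] above [y] makes the telescoping sum exceed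
   [x]. *)
move=> m1; pose y := expR (expR (x + ln (ln m%:R))).
exists (maxn m (Num.trunc y).+1); set n := maxn _ _.
apply: (@lt_le_trans _ _ (ln (ln n%:R) - ln (ln m%:R))); last first.
  rewrite -(@telescope_sumr _ m n (fun k => ln (ln k%:R))) ?leq_maxl//.
  apply: ler_sum_nat => k /andP[mk _]; apply: lnln_diff_le; lia.
have yn : y < n%:R.
  by apply: lt_le_trans (truncnS_gt y) _; rewrite ler_nat leq_maxr.
have lnn : expR (x + ln (ln m%:R)) < ln n%:R.
  by rewrite -[ltLHS]expRK ltr_ln ?posrE ?expR_gt0// (lt_trans _ yn)// expR_gt0.
rewrite ltrBrDr -[ltLHS]expRK ltr_ln ?posrE ?expR_gt0//.
by rewrite (lt_trans _ lnn)// expR_gt0.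
Qed.

End LogLog.

Lemma exists_trace_card_lt (R : realType) (F : set (set nat)) (e : R) (m : nat) :
  antichain F -> 0 < e ->
  exists2 n, (m <= n)%N &
    (trace_card F n)%:R * (2 ^+ n / (n%:R * ln n%:R))^-1 < e.
Proof.
move=> antiF e0; apply: contrapT => nex.
(* Starting at 2 or later keeps ln k positive. If the claim fails, every k >= p has s_k / 2^k >= e /
   (k ln k), so a partial sum of 1 / (k ln k) beyond 2 / e contradicts the bound 2. *)
pose p := maxn m 2.
have [n] := @sum_inv_nlnn_unbounded R p (2 / e) (leq_maxr _ _).
apply/negP; rewrite -leNgt ler_pdivlMr//.
apply: le_trans (sum_trace_card_le2 antiF R n).
have [pn|/ltnW np] := leqP p n; last first.
  by rewrite big_geq// mul0r sumr_ge0// => k _; rewrite divr_ge0// exprn_ge0.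
rewrite [leRHS](@big_cat_nat _ _ _ p)//=.
apply: ler_wpDl; first by rewrite sumr_ge0// => k _; rewrite divr_ge0// exprn_ge0.
rewrite mulr_suml; apply: ler_sum_nat => k /andP[pk _].
have k0 : 0 < k%:R :> R by rewrite ltr0n; lia.
have lnk0 : 0 < ln k%:R :> R by rewrite ln_gt0// ltr1n; lia.
have : e <= (trace_card F k)%:R * (2 ^+ k / (k%:R * ln k%:R))^-1.
  rewrite leNgt; apply/negP => lt_e; apply: nex; exists k => //; lia.
by rewrite invf_div mulrCA => le_e; rewrite mulrC ler_pdivrMr ?mulr_gt0// mulrC.
Qed.

Theorem theorem1 (R : realType) (F : set (set nat)) :
  antichain F ->
  limn_einf (fun n : nat =>
    ((trace_card F n)%:R * (2 ^+ n / (n%:R * ln n%:R))^-1 : R)%:E) = 0%E.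
Proof.
move=> antiF; set u := (fun n : nat => _); rewrite limn_einf_lim.
apply/eqP; rewrite eq_le; apply/andP; split.
  (* Every tail infimum is at most any e > 0, because some term of that tail is below e. *)
  apply: lime_le; first exact: is_cvg_einfs.
  apply: nearW => m; apply/lee_addgt0Pr => e e0; rewrite add0e.
  have [n mn ltne] := exists_trace_card_lt m antiF e0.
  apply: (@le_trans _ _ (u n)); last by rewrite lee_fin ltW.
  by apply: ereal_inf_lbound; exists n.
apply: lime_ge; first exact: is_cvg_einfs.
apply: nearW => m; apply: le_ereal_inf_tmp => _ [n _ <-].
rewrite lee_fin mulr_ge0// invr_ge0 divr_ge0 ?exprn_ge0// mulr_ge0//.
(* At n = 0 the sign relies on the default value ln 0 = 0. *)
by case: n => [|n]; [rewrite ln0|rewrite ln_ge0// ler1n].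
Qed.
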